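(* Let $(X,d)$ be a complete metric space that is countably compact, and let $\mathcal S=(X,(f_i)_{i\in I})$ be an Infinite Iterated Function System of contractions that is locally finite and non-overlapping, with attractor $A=A(\mathcal S)$. Then the canonical projection $\pi:\Lambda(I)\to A$ is surjective.
   Context: $X$ and $I$ are nonempty. For a map $f$ between metric spaces, $\mathrm{lip}(f)=\sup_{x\neq y}d(f(x),f(y))/d(x,y)$. An Infinite Iterated Function System (IIFS) of contractions on $(X,d)$ is a family $(f_i)_{i\in I}$ of selfmaps of $X$ such that $\bigcup_{i\in I}f_i(B)$ is bounded for every bounded $B\subseteq X$ and $\sup_{i\in I}\mathrm{lip}(f_i)<1$. It is non-overlapping if $f_i(B)\cap f_j(B)=\varnothing$ for all $B\subseteq X$ and all $i\ne j$ in $I$ (equivalently $f_i(X)\cap f_j(X)=\varnothing$ for $i\ne j$). It is locally finite if every $y\in X$ has a neighbourhood $V_y$ such that $\{i\in I: V_y\cap f_i(X)\neq\varnothing\}$ is finite. The attractor $A(\mathcal S)$ is the unique nonempty closed bounded set $A\subseteq X$ with $\overline{\bigcup_{i\in I}f_i(A)}=A$. The shift space is $\Lambda(I)=I^{\mathbb N}$, $\mathbb N=\{1,2,\dots\}$. For $\omega\in\Lambda(I)$, $\pi(\omega)=a_\omega$ is the unique point of $\bigcap_{m\ge1}f_{\omega_1}\circ\cdots\circ f_{\omega_m}(A)$; equivalently $a_\omega=\lim_{m\to\infty}f_{\omega_1}\circ\cdots\circ f_{\omega_m}(a)$ for any $a\in A$. *)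

(* Defs.v *)
From HB Require Import structures.
From mathcomp Require Import all_boot all_order all_algebra.
From mathcomp Require Import all_classical all_reals all_analysis.

Set Implicit Arguments.
Unset Strict Implicit.
Unset Printing Implicit Defensive.

Import Order.TTheory GRing.Theory Num.Theory.

Local Open Scope classical_set_scope.
Local Open Scope ring_scope.

(* [Complete] extends [Pointed], so these spaces are nonempty. *)
#[short(type="completeMetricType")]
HB.structure Definition CompleteMetric (R : realType) :=
  {T of CompletePseudoMetric R T & Metric R T}.

Definition countably_compact (T : topologicalType) (A : set T) : Prop :=
  forall U : nat -> set T, (forall n, open (U n)) ->
    A `<=` cover setT U -> finite_subset_cover setT U A.

Definition metric_bounded (R : realType) (X : metricType R) (B : set X) : Prop :=
  exists (x : X) (r : R), B `<=` ball x r.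

(* On a one-point space the supremum is over the empty set and equals -oo
   instead of 0; this does not affect conditions of the form [lip f < 1]. *)
Definition lip (R : realType) (X Y : metricType R) (f : X -> Y) : \bar R :=
  ereal_sup [set (mdist (f p.1) (f p.2) / mdist p.1 p.2)%:E
            | p in [set p : X * X | p.1 <> p.2]].

Section IIFS.
Context (R : realType) (X : completeMetricType R) (I : Type).
Implicit Types (f : I -> X -> X) (A : set X) (w : nat -> I).

Definition is_iifs f : Prop :=
  (forall B : set X, metric_bounded B ->
     metric_bounded (\bigcup_i (f i @` B))) /\
  (ereal_sup (range (fun i => lip (f i))) < 1%:E)%E.

Definition non_overlapping f : Prop :=
  forall (i j : I) (B : set X), i <> j -> f i @` B `&` f j @` B = set0.

Definition locally_finite f : Prop :=
  forall y : X, exists2 V : set X, nbhs y V &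
    finite_set [set i | V `&` range (f i) !=set0].

Definition is_attractor f A : Prop :=
  [/\ A !=set0, closed A, metric_bounded A &
      closure (\bigcup_i (f i @` A)) = A].

(* Words are indexed from 0: [word_map f w m] is
   f (w 0) \o f (w 1) \o ... \o f (w (m - 1)). *)
Fixpoint word_map f w (m : nat) : X -> X :=
  if m is m'.+1 then word_map f w m' \o f (w m') else id.

(* For an IIFS with attractor A the intersection is a singleton, and [get]
   selects its only element. *)
Definition canonical_projection f A w : X :=
  get (\bigcap_(m in [set m | (1 <= m)%N]) (word_map f w m @` A)).

End IIFS.

(* Main.v *)
Require Import Defs.
From HB Require Import structures.
From mathcomp Require Import all_boot all_order all_algebra.
From mathcomp Require Import all_classical all_reals all_analysis.

(** Every point y of A has an address once A is the union of the pieces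
    f_i(A), and not merely the closure of that union: choose i with y = f_i(a)
    and a in A, repeat with a, and the indices met on the way form a word w
    such that y lies in f_(w 0) o ... o f_(w (m-1)) (A) for all m.  The
    diameters of these sets tend to 0, so y is the only point common to all of
    them, hence the projection of w ([attractor_code], [word_image_unique]).

    That no closure is needed combines the two finiteness hypotheses.  By
    countable compactness each f_i(A) is closed
    ([closed_image_countably_compact]), and by local finiteness the union of
    these closed sets is closed ([closed_bigcup_locally_finite]).

    Countable compactness also shows that the projection takes its values in
    A: the sets f_(w 0) o ... o f_(w (m-1)) (A) are closed, nonempty and
    decreasing, so they have a common point ([countably_compact_bigcap]). *)

Set Implicit Arguments.
Unset Strict Implicit.
Unset Printing Implicit Defensive.

Import Order.TTheory GRing.Theory Num.Theory.
Import numFieldNormedType.Exports.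

Local Open Scope classical_set_scope.
Local Open Scope ring_scope.

(** If the intersection were empty, the complements of the F n would be an open
    cover, and a finite subcover would make some F n empty. *)
Lemma countably_compact_bigcap (T : topologicalType) (F : nat -> set T) :
  countably_compact [set: T] ->
  (forall n, closed (F n)) -> (forall n, F n !=set0) ->
  (forall m n, (m <= n)%N -> F n `<=` F m) ->
  \bigcap_n F n !=set0.
Proof.
move=> cT Fcl F0 Fdec; apply: contrapT => F_empty.
have [n|x _|D _ Dcov] := cT (fun n => ~` F n).
- exact/closed_openC.
- apply: contrapT => xF; apply: F_empty; exists x => n _.
  by apply: contrapT => xFn; apply: xF; exists n.
have [x xF] := F0 (\max_(i <- finmap.enum_fset D) i)%N.
have [i /= iD] := Dcov x I; apply.
by apply: Fdec xF; apply: (@leq_bigmax_seq _ _ xpredT id).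
Qed.

(** A point y adherent to g(A) is a value of g on A because the closed sets
    A `&` g^-1(closed ball of radius 1/(n+1) around y) are nonempty and
    decreasing: g maps any common point of them to y. *)
Lemma closed_image_countably_compact (R : realType) (T : topologicalType)
    (Y : metricType R) (g : T -> Y) (A : set T) :
  countably_compact [set: T] -> continuous g -> closed A -> closed (g @` A).
Proof.
move=> cT gc Acl y gAy.
pose F n := A `&` g @^-1` closed_ball y n.+1%:R^-1.
have [||m n mn|a aF] := @countably_compact_bigcap T F cT.
- move=> n; apply: closedI => //.
  by apply: preimage_closed => [? _|]; [exact: gc | exact: closed_ball_closed].
- move=> n; have [|_ [[a Aa <-] yga]] := gAy (ball y n.+1%:R^-1).
    by apply: nbhsx_ballx; rewrite invr_gt0.
  by exists a; split => //; exact: subset_closed_ball.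
- apply: setIS; apply: preimage_subset; apply: le_closed_ball.
  by rewrite lef_pV2 ?posrE// ler_nat.
exists a; first by case: (aF 0 I).
apply: esym; apply: contrapT => /eqP; rewrite -mdist_gt0 => d_gt0.
(* The halving compensates for the closure of a ball of radius r/2 being only
   known to lie in the open ball of radius r. *)
have /ltr_add_invr[n] : 0 < mdist y (g a) / 2 by rewrite divr_gt0.
rewrite add0r => n_lt.
have [_ /= ga] := aF n I.
have : ball y (mdist y (g a)) (g a).
  apply: subset_closure_half => //.
  by apply: le_closed_ball ga; exact: ltW.
by rewrite ballEmdist /= ltxx.
Qed.

(** Near a given point the union coincides with a finite union of closed
    sets. *)
Lemma closed_bigcup_locally_finite (T : topologicalType) (I : Type)
    (B : I -> set T) :
  (forall i, closed (B i)) ->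
  (forall y : T, exists2 V : set T, nbhs y V &
     finite_set [set i | V `&` B i !=set0]) ->
  closed (\bigcup_i B i).
Proof.
move=> Bcl Blf y By; have [V yV Vfin] := Blf y.
suff /(_ y) : closed (\bigcup_(i in [set i | V `&` B i !=set0]) B i).
  case=> [U yU|i _ Biy]; last by exists i.
  have [z [[i _ Biz] [Uz Vz]]] := By _ (filterI yU yV).
  by exists z; split => //; exists i => //; exists z.
(* Finite unions are taken over a choice type, whence the classical alias. *)
exact: (@closed_bigcup T {classic I}).
Qed.

Section IIFS.
Context (R : realType) (X : completeMetricType R) (I : Type).
Implicit Types (f : I -> X -> X) (A : set X) (w : nat -> I).

Lemma iifs_contraction f : is_iifs f ->
  exists2 c : R, 0 <= c < 1 &
    forall i x y, mdist (f i x) (f i y) <= c * mdist x y.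
Proof.
move=> [_ lip_lt1].
pose s := ereal_sup (range (fun i => lip (f i))).
have ratio_le i x y : x <> y ->
    ((mdist (f i x) (f i y) / mdist x y)%:E <= s)%E.
  move=> xy; apply: (@le_trans _ _ (lip (f i))).
    by apply: ereal_sup_ubound; exists (x, y).
  by apply: ereal_sup_ubound; exists i.
(* Truncation at 0 is needed: the supremum is -oo on a one-point space. *)
exists (Num.max 0 (fine s)).
  rewrite le_max lexx gt_max ltr01 /=.
  by move: lip_lt1; rewrite -/s; case: s {ratio_le} => //= r.
move=> i x y; have [->|/eqP xy] := eqVneq x y; first by rewrite !mdistxx mulr0.
have d_gt0 : 0 < mdist x y by rewrite mdist_gt0; exact/eqP.
rewrite -ler_pdivrMr// le_max; apply/orP; right.
move: (ratio_le i x y xy) lip_lt1; rewrite -/s.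
by case: s {ratio_le}.
Qed.

Section Contraction.
Context (f : I -> X -> X) (c : R) (c01 : 0 <= c < 1).
Context (fc : forall i x y, mdist (f i x) (f i y) <= c * mdist x y).

Lemma word_map_contraction w m x y :
  mdist (word_map f w m x) (word_map f w m y) <= c ^+ m * mdist x y.
Proof.
have /andP[c0 _] := c01.
elim: m x y => [|m IH] x y /=; first by rewrite mul1r.
by rewrite (le_trans (IH _ _))// exprSr -mulrA ler_wpM2l ?exprn_ge0.
Qed.

Lemma word_map_continuous w m : continuous (word_map f w m).
Proof.
have /andP[c0 c1] := c01.
move=> x; apply/metricType_numDomainType.cvgrPdist_lt => e e0.
apply/metricType_numDomainType.nbhs_mdistP; exists e => //= y xy.
apply: (le_lt_trans (word_map_contraction w m x y)); apply: le_lt_trans xy.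
by rewrite ler_piMl ?mdist_ge0// exprn_ile1// ltW.
Qed.

(** The set f_(w 0) o ... o f_(w (m-1)) (A) has diameter at most c^m times that
    of A. *)
Lemma word_image_unique w A x y : metric_bounded A ->
  (forall m, (0 < m)%N -> (word_map f w m @` A) x) ->
  (forall m, (0 < m)%N -> (word_map f w m @` A) y) -> x = y.
Proof.
have /andP[c0 c1] := c01.
move=> [z [r Ar]] wx wy; apply: mdist_positivity.
have d_le m : mdist x y <= c ^+ m.+1 * (r + r).
  have [a Aa <-] := wx m.+1 isT; have [b Ab <-] := wy m.+1 isT.
  rewrite (le_trans (word_map_contraction _ _ _ _))// ler_wpM2l ?exprn_ge0//.
  rewrite (le_trans (metric_triangle a z b))//.
  move: (Ar _ Aa) (Ar _ Ab); rewrite ballEmdist/= metric_sym => za zb.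
  by rewrite lerD// ltW.
apply/eqP; rewrite eq_le mdist_ge0 andbT.
have lim0 : geometric (c * (r + r)) c @ \oo --> (0 : R).
  by apply: cvg_geometric; rewrite ger0_norm.
rewrite -(cvg_lim _ lim0)//; apply: limr_ge; first by apply/cvg_ex; exists 0.
by apply: nearW => m; rewrite /geometric /= mulrAC -exprS.
Qed.

End Contraction.

(** The word records the indices along a backward orbit of y inside A: each
    point of the orbit is the image, under the map so indexed, of the next
    one. *)
Lemma attractor_code f A y : (forall x, A x -> exists i, (f i @` A) x) ->
  A y -> exists w, forall m, (word_map f w m @` A) y.
Proof.
move=> Acov Ay.
have [i0 _] := Acov y Ay.
have /choice[g gP] x : exists ia : I * X, A x -> A ia.2 /\ f ia.1 ia.2 = x.
  have [/Acov[i [a Aa <-]]|nAx] := pselect (A x); first by exists (i, a).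
  by exists (i0, x).
pose orb m := iter m (fun x => (g x).2) y.
have Aorb m : A (orb m) by elim: m => //= m IH; have [] := gP _ IH.
exists (fun m => (g (orb m)).1) => m; exists (orb m) => //.
by elim: m => //= m IH; have [_ ->] := gP _ (Aorb m).
Qed.

End IIFS.

Local Close Scope ring_scope.

Theorem proposition6p2 (R : realType) (X : completeMetricType R) (I : Type)
    (f : I -> X -> X) (A : set X) :
  [set: I] !=set0 ->
  countably_compact [set: X] ->
  is_iifs f ->
  locally_finite f ->
  non_overlapping f ->
  is_attractor f A ->
  set_fun [set: nat -> I] A (canonical_projection f A) /\
  set_surj [set: nat -> I] A (canonical_projection f A).
Proof.
move=> _ cX /iifs_contraction[c c01 fc] flf _ [A0 Acl Abd Aeq].
have subA i : f i @` A `<=` A.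
  by rewrite -{2}Aeq => x fAx; apply: subset_closure; exists i.
have fcont i : continuous (f i).
  by have := @word_map_continuous _ _ _ _ _ c01 fc (fun=> i) 1%N.
have Acov x : A x -> exists i, (f i @` A) x.
  rewrite -{1}Aeq -(closure_id _).1 => [[i _ ?]|]; first by exists i.
  apply: closed_bigcup_locally_finite => [i|y].
    exact: closed_image_countably_compact.
  have [V yV Vfin] := flf y; exists V => //.
  apply: sub_finite_set Vfin => i [z [Vz [a _ fa]]].
  by exists z; split => //; exists a.
pose F w m := word_map f w m @` A.
have Fdec w m n : (m <= n)%N -> F w n `<=` F w m.
  move=> /subnK <-; elim: (n - m)%N => // k IH.
  apply: subset_trans IH => _ [a Aa <-]; exists (f (w (k + m)%N) a) => //.
  by apply: (subA (w (k + m)%N)); exists a.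
(* Compactness provides a common point of the sets F w m, so [get] selects one
   rather than a default value. *)
have projP w : (\bigcap_(m in [set m | (1 <= m)%N]) F w m)
                 (canonical_projection f A w).
  apply: getPex.
  have [|||x xF] := @countably_compact_bigcap X (F w) cX.
  - move=> m; apply: closed_image_countably_compact => //.
    exact: word_map_continuous c01 fc _ _.
  - by move=> m; case: A0 => a Aa; exists (word_map f w m a), a.
  - exact: Fdec.
  - by exists x => m _; exact: xF.
split=> [w _|y Ay].
  have [a Aa <-] := projP w 1%N isT.
  by apply: (subA (w 0%N)); exists a.
have [w wy] := attractor_code Acov Ay.
exists w => //; apply: (@word_image_unique _ _ _ _ _ c01 fc w A) => //.
exact: projP.
Qed.
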